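(* Let $p$ be a prime and let $\rho=\begin{pmatrix}\alpha_1&\alpha_2\\ \beta_1&\beta_2\end{pmatrix}\in\mathrm{GL}_2(p)$. Then $\rho$ induces an automorphism $\widehat\rho$ of $F_p$ by $$\widehat\rho(x)=(\alpha_1,\alpha_2,0,0,0,0)=x^{\alpha_1}y^{\alpha_2},\qquad \widehat\rho(y)=(\beta_1,\beta_2,0,0,0,0)=x^{\beta_1}y^{\beta_2},$$ where $x=(1,0,0,0,0,0)$ and $y=(0,1,0,0,0,0)$ are the free generators of $F_p$. Moreover, if $\lambda\in\mathrm{Aut}\,F_p$ then there are $\rho\in\mathrm{GL}_2(p)$ and $\sigma\in\mathrm{Aut}\,F_p$ such that $\lambda=\widehat\rho\sigma$ and $\sigma(z)=z$ for every $z\in Z(F_p)$.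
   Context: Elements of $\mathbb Z_p$ are identified with the integers $0,\dots,p-1$. For $0\le a,b<p$ let $(a,b)_p=0$ if $a+b<p$ and $(a,b)_p=1$ otherwise. $F_p$ is the commutative automorphic loop on $(\mathbb Z_p)^6$ with multiplication $$(a_1,\dots,a_6)(b_1,\dots,b_6)=(a_1+b_1,\ a_2+b_2,\ a_3+b_3+(a_1,b_1)_p,\ a_4+b_4+(a_2,b_2)_p,\ a_5+b_5-a_1b_1(a_2+b_2),\ a_6+b_6+a_2b_2(a_1+b_1)).$$ It is the free loop on the two generators $x,y$ in the variety of commutative automorphic loops of nilpotency class at most two satisfying $a^{p^2}=1$ and $(a,b,c)^p=1$, where the associator $(a,b,c)$ is defined by $(ab)c=(a(bc))(a,b,c)$. $Z(F_p)$ is the center of $F_p$ (elements that commute and associate with all elements), and $Z(F_p)=0\times0\times(\mathbb Z_p)^4$. A loop is automorphic if its inner mappings (the group generated by $L_{yx}^{-1}L_yL_x$, $R_{xy}^{-1}R_yR_x$, $L_x^{-1}R_x$, with $L_x(y)=xy$, $R_x(y)=yx$) are automorphisms. *)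

(* Defs.v *)
From HB Require Import structures.
From mathcomp Require Import all_boot all_order all_algebra all_fingroup.

Set Implicit Arguments.
Unset Strict Implicit.
Unset Printing Implicit Defensive.

Import GRing.Theory.
Local Open Scope ring_scope.

Section FiniteLoops.
Variables (T : finType) (mul : T -> T -> T) (e : T).

Definition is_loop : Prop :=
  [/\ left_id e mul, right_id e mul,
      forall a, bijective (mul a) & forall a, bijective (mul^~ a)].

Definition in_center (z : T) : Prop :=
  forall u v, [/\ mul z u = mul u z,
                  mul (mul z u) v = mul z (mul u v),
                  mul (mul u z) v = mul u (mul z v) &
                  mul (mul u v) z = mul u (mul v z)].

(* In a loop, a bijection preserving the product also preserves the identity
   and both divisions. *)
Definition is_loop_aut (f : {perm T}) : Prop := {morph f : u v / mul u v}.

Definition loop_pow (a : T) (n : nat) : T := iter n (mul a) e.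

End FiniteLoops.

Section FreeLoop.
Variable p : nat.

(* For p prime, 'F_p is the set of residues 0, ..., p-1, and its elements coerce
   to these representatives in nat. *)
Definition carry (a b : 'F_p) : 'F_p := if (a + b < p)%N then 0 else 1.

Definition Floop : Type := ('F_p * 'F_p * 'F_p * 'F_p * 'F_p * 'F_p)%type.
HB.instance Definition _ := Finite.on Floop.

Definition Fmul (a b : Floop) : Floop :=
  let: (a1, a2, a3, a4, a5, a6) := a in
  let: (b1, b2, b3, b4, b5, b6) := b in
  (a1 + b1,
   a2 + b2,
   a3 + b3 + carry a1 b1,
   a4 + b4 + carry a2 b2,
   a5 + b5 - a1 * b1 * (a2 + b2),
   a6 + b6 + a2 * b2 * (a1 + b1)).

Definition Fone : Floop := (0, 0, 0, 0, 0, 0).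
Definition Fx : Floop := (1, 0, 0, 0, 0, 0).
Definition Fy : Floop := (0, 1, 0, 0, 0, 0).

Definition Fpow (a : Floop) (n : nat) : Floop := loop_pow Fmul Fone a n.

Definition Faut (f : {perm Floop}) : Prop := is_loop_aut Fmul f.

Definition Fcenter (z : Floop) : Prop := in_center Fmul z.

Definition induced_aut (rho : {'GL_2(p)}) (f : {perm Floop}) : Prop :=
  [/\ Faut f,
      f Fx = (rho 0 0, rho 0 1, 0, 0, 0, 0) &
      f Fy = (rho 1 0, rho 1 1, 0, 0, 0, 0)].

Lemma FmulC : commutative Fmul.
Proof.
move=> [[[[[a1 a2] a3] a4] a5] a6] [[[[[b1 b2] b3] b4] b5] b6] /=.
rewrite /carry (addnC b1) (addnC b2) (addrC b1) (addrC b2) (addrC b3).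
by rewrite (addrC b4) (addrC b5) (addrC b6) (mulrC b1) (mulrC b2).
Qed.

Lemma Fmul_is_loop (pr_p : prime p) : is_loop Fmul Fone.
Proof.
have e1 : left_id Fone Fmul.
  move=> [[[[[a1 a2] a3] a4] a5] a6] /=.
  have lt_p (c : 'F_p) : (c < p)%N by rewrite -[X in (_ < X)%N]Fp_cast // ltn_ord.
  by rewrite /carry !add0n !lt_p !add0r !addr0 !mul0r subr0 addr0.
have injm a : injective (Fmul a).
  case: a => [[[[[a1 a2] a3] a4] a5] a6].
  move=> [[[[[b1 b2] b3] b4] b5] b6] [[[[[c1 c2] c3] c4] c5] c6] /=.
  by case/pair_equal_spec=> [/pair_equal_spec[/pair_equal_spec[/pair_equal_spec[
    /pair_equal_spec[/addrI-> /addrI->]]]]]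
    /addIr/addrI-> /addIr/addrI-> /addIr/addrI-> /addIr/addrI->.
split=> // [a|a|a]; first by rewrite FmulC.
  exact: injF_bij.
by apply: injF_bij => u v /=; rewrite ![Fmul _ a]FmulC; apply: injm.
Qed.

End FreeLoop.

(* Main.v *)
Require Import Defs.
From mathcomp Require Import all_boot all_order all_algebra all_fingroup.
From mathcomp Require Import ring.

(** The loop is a central extension of Z_p x Z_p by (Z_p)^4, with cocycle
      theta (a, b) = (carry a1 b1, carry a2 b2, - T1 (a, b), T2 (a, b)),
      T1 (a, b) = a1 b1 (a2 + b2),   T2 (a, b) = a2 b2 (a1 + b1).
    Write delta g (a, b) = g (a + b) - g a - g b for the coboundary of a
    function g.

    Existence.  To lift a linear map rho of Z_p x Z_p to an endomorphism of
    the loop is to find a linear map M on (Z_p)^4 and a correction g such that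
      theta (rho a, rho b) = M (theta (a, b)) + delta g (a, b).
    For the carries this holds because carry m n is the coboundary of
    n |-> floor (n / p) on natural numbers (carry_nat), whence carry_lin.
    Expanding the cubic T1 (rho a, rho b) gives three kinds of terms:
    multiples of (det rho) T1 and (det rho) T2, coboundaries of the
    monomials a1^2 a2 and a1 a2^2, and multiples of the one variable cocycle
    a b (a + b).  The latter is the coboundary of (a^3 - a) / 3 when p <> 3.
    For p = 3 it is not a coboundary, but (n^3 - n) / 3 still makes sense for
    a natural number n, and comparing its value at a + b in nat and at the
    residue of a + b yields a b (a + b) as a multiple of carry a b plus a
    coboundary, for every prime (cubic_carry).  Together these give cubic_lin,
    and the explicit lift Fhat, a morphism by FhatM.  It is block triangular
    with diagonal blocks rho, rho, (det rho) rho, hence injective when rho is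
    invertible (Fhat_inj).

    Uniqueness.  The elements x and y generate the loop (Fgen_ind).

    Decomposition.  By the same generation property, a map to Z_p that turns
    products into sums is a linear form in the first two coordinates
    (additive_ab).  So an automorphism lambda induces a linear map rho on the
    first two coordinates, which is invertible since lambda is onto (Faut_ab).
    Then sigma = hat_rho^-1 lambda fixes these two coordinates, so it changes
    each of the other four by a map that turns products into sums: the cocycle
    terms cancel.  That change is again a linear form in the first two
    coordinates, and these are zero on the center (Fcenter_ab). *)

Set Implicit Arguments.
Unset Strict Implicit.
Unset Printing Implicit Defensive.

Import GRing.Theory.
Local Open Scope ring_scope.

(** * Carries and the cubic cocycle over the prime field *)

Section Cocycles.
Variables (p : nat) (pr_p : prime p).
Implicit Types (a b al be : 'F_p) (m n : nat).

Definition quo_Fp n : 'F_p := (n %/ p)%:R.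

Lemma Fp_nat_lt a : (a < p)%N.
Proof. by rewrite -[X in (_ < X)%N](Fp_cast pr_p) ltn_ord. Qed.

Lemma quo_Fp_small n : (n < p)%N -> quo_Fp n = 0.
Proof. by move=> lt_np; rewrite /quo_Fp divn_small. Qed.

Lemma quo_FpDMl n m : quo_Fp (n + m * p) = quo_Fp n + m%:R.
Proof. by rewrite /quo_Fp addnC divnMDl ?prime_gt0 // natrD addrC. Qed.

Lemma addFp_nat a b : (a + b = (a + b)%R + (p <= a + b) * p)%N.
Proof.
have -> : ((a + b)%R : nat) = ((a + b) %% p)%N.
  by rewrite -(val_Fp_nat pr_p) natrD !natr_Zp.
rewrite {1}(divn_eq (a + b) p) addnC; congr (_ + _ * _)%N.
have lt_ap := Fp_nat_lt a; have lt_bp := Fp_nat_lt b.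
by rewrite divnD ?prime_gt0 // !divn_small // !modn_small.
Qed.

Lemma carryE a b : carry a b = (p <= a + b)%N%:R.
Proof. by rewrite /carry; case: ltnP. Qed.

(** Adding n to m carries exactly when the quotient of m + n by p exceeds the
    sum of the quotients; this is how carries become coboundaries over nat. *)
Lemma carry_nat m n : carry m%:R n%:R = quo_Fp (m + n) - quo_Fp m - quo_Fp n.
Proof.
rewrite carryE !val_Fp_nat // /quo_Fp divnD ?prime_gt0 // !natrD.
by ring.
Qed.

Lemma carry0l a : carry 0 a = 0.
Proof. by rewrite /carry add0n Fp_nat_lt. Qed.

Lemma carry0r a : carry a 0 = 0.
Proof. by rewrite /carry addn0 Fp_nat_lt. Qed.

(** A linear form computed in nat on the representatives: its residue is the
    value of the form, and its quotient by p corrects the carries. *)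
Definition lin (al be a1 a2 : 'F_p) : nat := (al * a1 + be * a2)%N.

Lemma lin_natE al be a1 a2 : (lin al be a1 a2)%:R = al * a1 + be * a2.
Proof. by rewrite /lin natrD !natrM !natr_Zp. Qed.

(** Over nat, lin is additive, so lin a + lin b differs from lin (a + b) only
    by p times the linear form at the two carries. *)
Lemma carry_lin al be a1 a2 b1 b2 :
  carry (al * a1 + be * a2) (al * b1 + be * b2) =
    al * carry a1 b1 + be * carry a2 b2
    + (quo_Fp (lin al be (a1 + b1) (a2 + b2))
       - quo_Fp (lin al be a1 a2) - quo_Fp (lin al be b1 b2)).
Proof.
rewrite -(lin_natE _ _ a1) -(lin_natE _ _ b1) carry_nat !carryE.
set c1 := (p <= a1 + b1)%N; set c2 := (p <= a2 + b2)%N.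
have -> : (lin al be a1 a2 + lin al be b1 b2 =
           lin al be (a1 + b1)%R (a2 + b2)%R + (al * c1 + be * c2) * p)%N.
  transitivity (al * (a1 + b1) + be * (a2 + b2))%N.
    by rewrite /lin !mulnDr addnACA.
  rewrite (addFp_nat a1 b1) (addFp_nat a2 b2) -/c1 -/c2 /lin.
  by rewrite !mulnDr !mulnDl !mulnA addnACA.
by rewrite quo_FpDMl natrD !natrM !natr_Zp; ring.
Qed.

(** This is (n^3 - n) / 3; the sum avoids the division, which matters for
    p = 3. *)
Definition cube_third n : nat := \sum_(i < n) i * i.+1.

Lemma cube_third0 : cube_third 0 = 0%N.
Proof. by rewrite /cube_third big_ord0. Qed.

Lemma cube_thirdS n : (cube_third n.+1 = cube_third n + n * n.+1)%N.
Proof. by rewrite /cube_third big_ord_recr. Qed.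

Lemma cube_third1 : cube_third 1 = 0%N.
Proof. by rewrite cube_thirdS cube_third0. Qed.

Lemma cube_thirdD m n :
  (cube_third (m + n) = cube_third m + cube_third n + m * n * (m + n))%N.
Proof.
elim: n => [|n IHn]; first by rewrite addn0 cube_third0; ring.
by rewrite addnS !cube_thirdS IHn; ring.
Qed.

(** The natural number a + b is also the residue of a + b, plus p if there is a
    carry.  Expanding cube_third by cube_thirdD along both decompositions and
    reducing modulo p gives the identity.  The coefficient (p^3 - p) / 3
    vanishes modulo p unless p = 3, where it is -1. *)
Lemma cubic_carry a b :
  a * b * (a + b) =
    (cube_third p)%:R * carry a b
    + ((cube_third (a + b)%R)%:R - (cube_third a)%:R - (cube_third b)%:R).
Proof.
have nat_ab : (cube_third (a + b))%:R
    = (cube_third a)%:R + (cube_third b)%:R + a * b * (a + b) :> 'F_p.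
  by rewrite cube_thirdD !natrD !natrM natrD !natr_Zp.
have p0 : p%:R = 0 :> 'F_p by exact: pchar_Fp_0.
have: (cube_third (a + b))%:R
    = (cube_third (a + b)%R)%:R + (cube_third p)%:R * carry a b :> 'F_p.
  rewrite carryE [X in cube_third X]addFp_nat cube_thirdD !natrD !natrM p0.
  by case: leqP => _ /=; rewrite ?mul1n ?mul0n ?cube_third0; ring.
rewrite nat_ab => /(canRL (addKr _)) ->.
by ring.
Qed.

(** The correction for the cubic term: a sum of functions whose coboundaries
    are the parts of T1 (rho a, rho b) that are neither T1, T2 nor carries. *)
Definition cubic (al1 al2 be1 be2 a1 a2 : 'F_p) : 'F_p :=
  al1 ^+ 2 * al2 * (cube_third a1)%:R + be1 ^+ 2 * be2 * (cube_third a2)%:R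
  + al1 * be1 * (al2 * a1 ^+ 2 * a2 + be2 * a1 * a2 ^+ 2).

(** The mixed terms rest on
      (a1 b2 + a2 b1) (a1 + b1) = delta (a1^2 a2) - a1 b1 (a2 + b2)
    and its mirror image, which turn the coefficient of each cubic form into a
    multiple of the determinant; the terms in one variable are handled by
    cubic_carry.  Exchanging the indices 1 and 2 gives the identity for T2. *)
Lemma cubic_lin al1 al2 be1 be2 a1 a2 b1 b2 :
  (al1 * a1 + be1 * a2) * (al1 * b1 + be1 * b2)
    * ((al2 * a1 + be2 * a2) + (al2 * b1 + be2 * b2)) =
  (al1 * be2 - al2 * be1)
    * (al1 * (a1 * b1 * (a2 + b2)) - be1 * (a2 * b2 * (a1 + b1)))
  + (cube_third p)%:R
    * (al1 ^+ 2 * al2 * carry a1 b1 + be1 ^+ 2 * be2 * carry a2 b2)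
  + (cubic al1 al2 be1 be2 (a1 + b1) (a2 + b2)
     - cubic al1 al2 be1 be2 a1 a2 - cubic al1 al2 be1 be2 b1 b2).
Proof.
have carry_cubic a b : (cube_third p)%:R * carry a b
    = a * b * (a + b)
      - ((cube_third (a + b)%R)%:R - (cube_third a)%:R - (cube_third b)%:R).
  by rewrite cubic_carry addrK.
have -> : (cube_third p)%:R
      * (al1 ^+ 2 * al2 * carry a1 b1 + be1 ^+ 2 * be2 * carry a2 b2)
    = al1 ^+ 2 * al2 * ((cube_third p)%:R * carry a1 b1)
      + be1 ^+ 2 * be2 * ((cube_third p)%:R * carry a2 b2) by ring.
rewrite !carry_cubic /cubic.
by ring.
Qed.

End Cocycles.

(** * Auxiliary facts *)

(** Plain injection on such an equality would also unfold the arithmetic of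
    'F_p, hence the detour through an abstract type. *)
Lemma tuple6_inj p (a1 a2 a3 a4 a5 a6 b1 b2 b3 b4 b5 b6 : 'F_p) :
  (a1, a2, a3, a4, a5, a6) = (b1, b2, b3, b4, b5, b6) :> Floop p ->
  [/\ a1 = b1, a2 = b2 & a3 = b3] /\ [/\ a4 = b4, a5 = b5 & a6 = b6].
Proof.
move: a1 a2 a3 a4 a5 a6 b1 b2 b3 b4 b5 b6; rewrite /Floop.
by move: 'F_p => T ? ? ? ? ? ? ? ? ? ? ? ? [-> -> -> -> -> ->].
Qed.

Section Linear.
Variable F : fieldType.

Lemma cramer2 (al1 al2 be1 be2 x y x' y' : F) :
  al1 * be2 - al2 * be1 != 0 ->
  al1 * x + be1 * y = al1 * x' + be1 * y' ->
  al2 * x + be2 * y = al2 * x' + be2 * y' -> x = x' /\ y = y'.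
Proof.
move=> D0 e1 e2; split; apply: (mulfI D0).
  transitivity (be2 * (al1 * x + be1 * y) - be1 * (al2 * x + be2 * y)).
    by ring.
  by rewrite e1 e2; ring.
transitivity (al1 * (al2 * x + be2 * y) - al2 * (al1 * x + be1 * y)).
  by ring.
by rewrite e1 e2; ring.
Qed.

Lemma det_mx2 (A : 'M[F]_2) : \det A = A 0 0 * A 1 1 - A 0 1 * A 1 0.
Proof.
rewrite (expand_det_row _ ord0) !big_ord_recl big_ord0 /cofactor !det_mx11 !mxE.
rewrite /= expr0 expr1 addr0 mul1r mulN1r mulrN.
by congr (A _ _ * A _ _ - A _ _ * A _ _); apply: val_inj.
Qed.

End Linear.

(** * The lift of a linear map to the free loop *)

Section FreeLoop.
Variables (p : nat) (pr_p : prime p).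
Implicit Types (u v w : Floop p) (A : 'M['F_p]_2).

Definition ab1 u : 'F_p := u.1.1.1.1.1.
Definition ab2 u : 'F_p := u.1.1.1.1.2.

Lemma ab1M u v : ab1 (Fmul u v) = ab1 u + ab1 v.
Proof. by move: u v => [[[[[? ?] ?] ?] ?] ?] [[[[[? ?] ?] ?] ?] ?]. Qed.

Lemma ab2M u v : ab2 (Fmul u v) = ab2 u + ab2 v.
Proof. by move: u v => [[[[[? ?] ?] ?] ?] ?] [[[[[? ?] ?] ?] ?] ?]. Qed.

(** Rows of A are the images of x and y, so A acts on row vectors.  The last
    two coordinates carry opposite signs because the cocycle is (- T1, T2). *)
Definition Fhat A u : Floop p :=
  let: (a1, a2, a3, a4, a5, a6) := u in
  let: (al1, al2, be1, be2) := (A 0 0, A 0 1, A 1 0, A 1 1) in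
  let D := al1 * be2 - al2 * be1 in
  (al1 * a1 + be1 * a2,
   al2 * a1 + be2 * a2,
   al1 * a3 + be1 * a4 + quo_Fp p (lin al1 be1 a1 a2),
   al2 * a3 + be2 * a4 + quo_Fp p (lin al2 be2 a1 a2),
   D * (al1 * a5 + be1 * a6)
     - (cube_third p)%:R * (al1 ^+ 2 * al2 * a3 + be1 ^+ 2 * be2 * a4)
     - cubic al1 al2 be1 be2 a1 a2,
   D * (al2 * a5 + be2 * a6)
     + (cube_third p)%:R * (al2 ^+ 2 * al1 * a3 + be2 ^+ 2 * be1 * a4)
     + cubic al2 al1 be2 be1 a1 a2).

Lemma FhatM A : {morph Fhat A : u v / Fmul u v}.
Proof.
move=> [[[[[a1 a2] a3] a4] a5] a6] [[[[[b1 b2] b3] b4] b5] b6].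
rewrite /Fhat /=.
move: (A 0 0) (A 0 1) (A 1 0) (A 1 1) => al1 al2 be1 be2.
rewrite !(carry_lin pr_p) !(cubic_lin pr_p).
by congr (_, _, _, _, _, _); ring.
Qed.

(** The lift is block triangular, so the coordinates are recovered two at a
    time by solving the same invertible system. *)
Lemma Fhat_inj A : \det A != 0 -> injective (Fhat A).
Proof.
rewrite det_mx2 => D0.
move=> [[[[[a1 a2] a3] a4] a5] a6] [[[[[b1 b2] b3] b4] b5] b6].
rewrite /Fhat /=.
move: (A 0 0) (A 0 1) (A 1 0) (A 1 1) D0 => al1 al2 be1 be2 D0.
move=> /tuple6_inj[[e1 e2 e3] [e4 e5 e6]].
have [eab1 eab2] := cramer2 D0 e1 e2; rewrite eab1 eab2 in e3 e4 e5 e6 *.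
have [eab3 eab4] := cramer2 D0 (addIr _ e3) (addIr _ e4).
rewrite eab3 eab4 in e5 e6 *.
have e5' := mulfI D0 (addIr _ (addIr _ e5)).
have e6' := mulfI D0 (addIr _ (addIr _ e6)).
by have [-> ->] := cramer2 D0 e5' e6'.
Qed.

(** The corrections vanish at x: a representative is less than p, so quo_Fp is
    0, and cube_third is 0 at 0 and at 1. *)
Lemma Fhat_x A : Fhat A (Fx p) = (A 0 0, A 0 1, 0, 0, 0, 0).
Proof.
have lin_x (al be : 'F_p) : lin al be 1 0 = al.
  by rewrite /lin muln0 addn0 (val_Fp_nat pr_p 1) modn_small ?muln1 ?prime_gt1.
rewrite /Fhat /= !lin_x !(quo_Fp_small (Fp_nat_lt pr_p _)) /cubic.
rewrite (val_Fp_nat pr_p 1) modn_small ?prime_gt1 // cube_third0 cube_third1.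
by congr (_, _, _, _, _, _); ring.
Qed.

Lemma Fhat_y A : Fhat A (Fy p) = (A 1 0, A 1 1, 0, 0, 0, 0).
Proof.
have lin_y (al be : 'F_p) : lin al be 0 1 = be.
  by rewrite /lin muln0 add0n (val_Fp_nat pr_p 1) modn_small ?muln1 ?prime_gt1.
rewrite /Fhat /= !lin_y !(quo_Fp_small (Fp_nat_lt pr_p _)) /cubic.
rewrite (val_Fp_nat pr_p 1) modn_small ?prime_gt1 // cube_third0 cube_third1.
by congr (_, _, _, _, _, _); ring.
Qed.

Lemma ab1_Fhat A u : ab1 (Fhat A u) = A 0 0 * ab1 u + A 1 0 * ab2 u.
Proof. by move: u => [[[[[? ?] ?] ?] ?] ?]. Qed.

Lemma ab2_Fhat A u : ab2 (Fhat A u) = A 0 1 * ab1 u + A 1 1 * ab2 u.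
Proof. by move: u => [[[[[? ?] ?] ?] ?] ?]. Qed.

(** * Generation by x and y *)

Definition central (c3 c4 c5 c6 : 'F_p) : Floop p := (0, 0, c3, c4, c5, c6).

Lemma Fmul_central (a1 a2 a3 a4 a5 a6 c3 c4 c5 c6 : 'F_p) :
  Fmul (a1, a2, a3, a4, a5, a6) (central c3 c4 c5 c6)
    = (a1, a2, a3 + c3, a4 + c4, a5 + c5, a6 + c6).
Proof.
by rewrite /= !carry0r //; congr (_, _, _, _, _, _); ring.
Qed.

Lemma Fpow_central c3 c4 c5 c6 n :
  Fpow (central c3 c4 c5 c6) n
    = central (n%:R * c3) (n%:R * c4) (n%:R * c5) (n%:R * c6).
Proof.
elim: n => [|n IHn]; first by rewrite !mul0r.
rewrite /Fpow /loop_pow iterS -/(loop_pow _ _ _ _) -/(Fpow _ _) IHn.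
rewrite {1}/central Fmul_central -natr1.
by congr (_, _, _, _, _, _); ring.
Qed.

Lemma Fpow_x n : Fpow (Fx p) n = (n%:R, 0, quo_Fp p n, 0, 0, 0).
Proof.
elim: n => [|n IHn]; first by rewrite /quo_Fp div0n.
rewrite /Fpow /loop_pow iterS -/(loop_pow _ _ _ _) -/(Fpow _ _) IHn /=.
rewrite carry0l // (carry_nat pr_p 1) (quo_Fp_small (prime_gt1 pr_p)).
rewrite add1n -natr1.
by congr (_, _, _, _, _, _); ring.
Qed.

Lemma Fpow_y n : Fpow (Fy p) n = (0, n%:R, 0, quo_Fp p n, 0, 0).
Proof.
elim: n => [|n IHn]; first by rewrite /quo_Fp div0n.
rewrite /Fpow /loop_pow iterS -/(loop_pow _ _ _ _) -/(Fpow _ _) IHn /=.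
rewrite carry0l // (carry_nat pr_p 1) (quo_Fp_small (prime_gt1 pr_p)).
rewrite add1n -natr1.
by congr (_, _, _, _, _, _); ring.
Qed.

Lemma Fmul_xy_pow (a b : 'F_p) :
  Fmul (Fpow (Fx p) a) (Fpow (Fy p) b) = (a, b, 0, 0, 0, 0).
Proof.
rewrite Fpow_x Fpow_y /= !quo_Fp_small ?Fp_nat_lt // !natr_Zp.
by rewrite carry0l // carry0r //; congr (_, _, _, _, _, _); ring.
Qed.

(** The center is reached from x and y: the p-th powers of x and y generate
    coordinates 3 and 4, and associators generate 5 and 6.  Left division is
    needed to extract these associators. *)
Lemma Fgen_ind (P : Floop p -> Prop) :
    P (Fx p) -> P (Fy p) -> (forall u v, P u -> P v -> P (Fmul u v)) ->
    (forall u v, P u -> P (Fmul u v) -> P v) ->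
  forall u, P u.
Proof.
move=> Px Py PM PD u.
have P1 : P (Fone p).
  apply: (PD (Fx p)) => //.
  by have [_ -> _ _] := Fmul_is_loop pr_p.
have PX v n : P v -> P (Fpow v n).
  by move=> Pv; elim: n => // n IHn; apply: PM.
have p0 : p%:R = 0 :> 'F_p by exact: pchar_Fp_0.
have quo_p : quo_Fp p p = 1 by rewrite /quo_Fp divnn prime_gt0.
have P3 : P (central 1 0 0 0).
  by have := PX _ p Px; rewrite Fpow_x p0 quo_p.
have P4 : P (central 0 1 0 0).
  by have := PX _ p Py; rewrite Fpow_y p0 quo_p.
(* (x x) y = (x (x y)) c, where c is the associator. *)
have P5 : P (central 0 0 1 0).
  apply: (PD (Fmul (Fx p) (Fmul (Fx p) (Fy p)))).
    exact: PM Px (PM _ _ Px Py).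
  suff -> : Fmul (Fmul (Fx p) (Fmul (Fx p) (Fy p))) (central 0 0 1 0)
      = Fmul (Fmul (Fx p) (Fx p)) (Fy p).
    exact: PM (PM _ _ Px Px) Py.
  rewrite /= ?addr0 ?add0r !carry0l // !carry0r //.
  by congr (_, _, _, _, _, _); ring.
(* y (y x) = ((y y) x) c, the sign being opposite in coordinate 6. *)
have P6 : P (central 0 0 0 1).
  apply: (PD (Fmul (Fmul (Fy p) (Fy p)) (Fx p))).
    exact: PM (PM _ _ Py Py) Px.
  suff -> : Fmul (Fmul (Fmul (Fy p) (Fy p)) (Fx p)) (central 0 0 0 1)
      = Fmul (Fy p) (Fmul (Fy p) (Fx p)).
    exact: PM Py (PM _ _ Py Px).
  rewrite /= ?addr0 ?add0r !carry0l // !carry0r //.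
  by congr (_, _, _, _, _, _); ring.
move: u => [[[[[a1 a2] a3] a4] a5] a6].
suff -> : (a1, a2, a3, a4, a5, a6) =
    Fmul (Fmul (Fmul (Fmul (Fmul (Fpow (Fx p) a1) (Fpow (Fy p) a2))
      (Fpow (central 1 0 0 0) a3)) (Fpow (central 0 1 0 0) a4))
      (Fpow (central 0 0 1 0) a5)) (Fpow (central 0 0 0 1) a6).
  by do 5!(apply: (PM); last by apply: (PX)); apply: (PX).
rewrite Fmul_xy_pow !Fpow_central !natr_Zp.
rewrite /= !addr0 !(carry0r pr_p).
by congr (_, _, _, _, _, _); ring.
Qed.

(** * Automorphisms and the first two coordinates *)

Lemma Faut_ext (f g : {perm Floop p}) :
  Faut f -> Faut g -> f (Fx p) = g (Fx p) -> f (Fy p) = g (Fy p) -> f = g.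
Proof.
move=> fM gM efx efy; apply/permP; apply: Fgen_ind => // u v.
  by move=> eu ev; rewrite fM gM eu ev.
rewrite fM gM => -> /=.
have [_ _ /(_ (g u)) bij_gu _] := Fmul_is_loop pr_p.
exact: bij_inj.
Qed.

(** Both sides turn products into sums and agree at x and y; in particular h
    kills every p-th power and every associator. *)
Lemma additive_ab (h : Floop p -> 'F_p) :
    (forall u v, h (Fmul u v) = h u + h v) ->
  forall u, h u = h (Fx p) * ab1 u + h (Fy p) * ab2 u.
Proof.
move=> hM; apply: Fgen_ind; rewrite /ab1 /ab2 /=; try by ring.
  move=> u v; rewrite -!/(ab1 _) -!/(ab2 _) hM ab1M ab2M => -> ->.
  by ring.
move=> u v; rewrite -!/(ab1 _) -!/(ab2 _) hM ab1M ab2M => -> e.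
by apply: (addrI (h (Fx p) * ab1 u + h (Fy p) * ab2 u)); rewrite e; ring.
Qed.

(** Coordinate 5 of the associator condition for (z, x, x) gives z2 = 0, and
    for (z, x, y) it gives z1 = 0. *)
Lemma Fcenter_ab u : Fcenter u -> ab1 u = 0 /\ ab2 u = 0.
Proof.
move: u => [[[[[a1 a2] a3] a4] a5] a6] cu; rewrite /ab1 /ab2 /=.
have /= [_ /tuple6_inj[_ [_ e2 _]] _ _] := cu (Fx p) (Fx p).
have /= [_ /tuple6_inj[_ [_ e1 _]] _ _] := cu (Fx p) (Fy p).
move/eqP: e1; rewrite -subr_eq0 => /eqP e1.
move/esym/eqP: e2; rewrite -subr_eq0 => /eqP e2.
by split; [rewrite -[RHS]e1 | rewrite -[RHS]e2]; ring.
Qed.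

(** Since theta only sees the coordinates that sigma preserves, the change
    h (sigma u) - h u turns products into sums, so additive_ab makes it vanish
    on the center. *)
Lemma cocycle_coord_fixed (sigma : {perm Floop p}) (h : Floop p -> 'F_p)
    (theta : 'F_p -> 'F_p -> 'F_p -> 'F_p -> 'F_p) :
    Faut sigma -> ab1 \o sigma =1 ab1 -> ab2 \o sigma =1 ab2 ->
    (forall u v, h (Fmul u v)
       = h u + h v + theta (ab1 u) (ab2 u) (ab1 v) (ab2 v)) ->
  forall z, Fcenter z -> h (sigma z) = h z.
Proof.
move=> sM s1 s2 hM z /Fcenter_ab[z1 z2]; apply/eqP; rewrite -subr_eq0.
rewrite [_ - _](additive_ab (h := fun u => h (sigma u) - h u)).
  by rewrite z1 z2 !mulr0 addr0.
move=> u v; rewrite sM !hM -!/((_ \o sigma) _) !s1 !s2 /=.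
by ring.
Qed.

Lemma ab_trivial_fixes_center (sigma : {perm Floop p}) :
    Faut sigma -> ab1 \o sigma =1 ab1 -> ab2 \o sigma =1 ab2 ->
  forall z, Fcenter z -> sigma z = z.
Proof.
move=> sM s1 s2 z cz.
have fixed h theta hM := @cocycle_coord_fixed sigma h theta sM s1 s2 hM z cz.
have e3 : (sigma z).1.1.1.2 = z.1.1.1.2.
  apply: (fixed (fun u => u.1.1.1.2) (fun a1 _ b1 _ => carry a1 b1)).
  by move=> [[[[[? ?] ?] ?] ?] ?] [[[[[? ?] ?] ?] ?] ?].
have e4 : (sigma z).1.1.2 = z.1.1.2.
  apply: (fixed (fun u => u.1.1.2) (fun _ a2 _ b2 => carry a2 b2)).
  by move=> [[[[[? ?] ?] ?] ?] ?] [[[[[? ?] ?] ?] ?] ?].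
have e5 : (sigma z).1.2 = z.1.2.
  apply: (fixed (fun u => u.1.2) (fun a1 a2 b1 b2 => - (a1 * b1 * (a2 + b2)))).
  by move=> [[[[[? ?] ?] ?] ?] ?] [[[[[? ?] ?] ?] ?] ?].
have e6 : (sigma z).2 = z.2.
  apply: (fixed (fun u => u.2) (fun a1 a2 b1 b2 => a2 * b2 * (a1 + b1))).
  by move=> [[[[[? ?] ?] ?] ?] ?] [[[[[? ?] ?] ?] ?] ?].
move: (s1 z) (s2 z) e3 e4 e5 e6; rewrite /ab1 /ab2 /=.
move: (sigma z) => [[[[[? ?] ?] ?] ?] ?] {cz fixed}.
case: z => [[[[[? ?] ?] ?] ?] ?] /=.
by move=> -> -> -> -> -> ->.
Qed.

Lemma ex_induced_aut (rho : {'GL_2(p)}) :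
  exists f : {perm Floop p}, induced_aut rho f /\ f =1 Fhat (GLval rho).
Proof.
exists (perm (Fhat_inj (GL_det rho))); split; last exact: permE.
split; [|by rewrite permE Fhat_x|by rewrite permE Fhat_y].
by move=> u v; rewrite !permE FhatM.
Qed.

(** The matrix has the first two coordinates of f x and f y as rows.  It is
    invertible because the first two coordinates of the preimages of x and y
    under f are the rows of an inverse. *)
Lemma Faut_ab (f : {perm Floop p}) :
  Faut f -> exists rho : {'GL_2(p)}, forall u,
    ab1 (f u) = rho 0 0 * ab1 u + rho 1 0 * ab2 u /\
    ab2 (f u) = rho 0 1 * ab1 u + rho 1 1 * ab2 u.
Proof.
move=> fM.
have f1 u : ab1 (f u) = ab1 (f (Fx p)) * ab1 u + ab1 (f (Fy p)) * ab2 u.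
  by apply: (additive_ab (h := ab1 \o f)) => v w /=; rewrite fM ab1M.
have f2 u : ab2 (f u) = ab2 (f (Fx p)) * ab1 u + ab2 (f (Fy p)) * ab2 u.
  by apply: (additive_ab (h := ab2 \o f)) => v w /=; rewrite fM ab2M.
pose A : 'M['F_p]_2 := \matrix_(i, j)
  (if j == 0 then ab1 else ab2) (f (if i == 0 then Fx p else Fy p)).
have detA : \det A != 0.
  pose v := (f^-1)%g (Fx p); pose w := (f^-1)%g (Fy p).
  have fv : f v = Fx p by rewrite permKV.
  have fw : f w = Fy p by rewrite permKV.
  have v1 := f1 v; have v2 := f2 v; have w1 := f1 w; have w2 := f2 w.
  suff e : \det A * (ab1 v * ab2 w - ab2 v * ab1 w) = 1.
    apply/eqP => D0; move/eqP: e; rewrite D0 mul0r.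
    by rewrite eq_sym oner_eq0.
  transitivity (ab1 (f v) * ab2 (f w) - ab2 (f v) * ab1 (f w)).
    by rewrite v1 v2 w1 w2 det_mx2 !mxE /=; ring.
  by rewrite fv fw /ab1 /ab2 /=; ring.
have unitA : A \is a GRing.unit by rewrite [_ \is a _]unitmxE unitfE.
exists (FinRing.unit _ unitA) => u.
by rewrite /= !mxE f1 f2.
Qed.

End FreeLoop.

Theorem lemma4p1 (p : nat) (pr_p : prime p) :
  (forall rho : {'GL_2(p)},
    [/\ ((rho 0 0, rho 0 1, 0, 0, 0, 0) : Floop p) =
          Fmul (Fpow (Fx p) (rho 0 0)) (Fpow (Fy p) (rho 0 1)),
        ((rho 1 0, rho 1 1, 0, 0, 0, 0) : Floop p) =
          Fmul (Fpow (Fx p) (rho 1 0)) (Fpow (Fy p) (rho 1 1)) &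
        exists! f : {perm Floop p}, induced_aut rho f])
  /\
  (forall lambda : {perm Floop p}, Faut lambda ->
    exists (rho : {'GL_2(p)}) (hat_rho sigma : {perm Floop p}),
      [/\ induced_aut rho hat_rho,
          Faut sigma,
          (forall u, lambda u = hat_rho (sigma u)) &
          (forall z, Fcenter z -> sigma z = z)]).
Proof.
split=> [rho | lambda lambdaM].
  split; [by rewrite Fmul_xy_pow | by rewrite Fmul_xy_pow |].
  have [f [fP _]] := ex_induced_aut pr_p rho.
  exists f; split=> // g [gM gx gy]; case: fP => fM fx fy.
  by apply: Faut_ext; rewrite // ?gx ?gy.
have [rho lambda_ab] := Faut_ab pr_p lambdaM.
have [f [fP fE]] := ex_induced_aut pr_p rho.
have [fM _ _] := fP.
pose sigma := (lambda * f^-1)%g.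
have lambdaE u : lambda u = f (sigma u) by rewrite permM permKV.
have sigmaM : Faut sigma.
  by move=> u v; apply: (@perm_inj _ f); rewrite fM -!lambdaE lambdaM.
have sigma_ab u : ab1 (sigma u) = ab1 u /\ ab2 (sigma u) = ab2 u.
  have [e1 e2] := lambda_ab u.
  rewrite lambdaE fE ab1_Fhat in e1; rewrite lambdaE fE ab2_Fhat in e2.
  by have := GL_det rho; rewrite det_mx2 => D0; apply: cramer2 D0 e1 e2.
exists rho, f, sigma; split=> //.
by apply: ab_trivial_fixes_center => // u; case: (sigma_ab u).
Qed.
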